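(* Let $\{f_i\}_{i\in I}$ be a frame for a separable Hilbert space $\mathcal H$ with frame operator $S$. Then for any $\lambda\in\mathbb R$, all $J\subset I$ and any $f\in\mathcal H$, $$0\le\sum_{i\in J}|\langle f,f_i\rangle|^2-\sum_{i\in I}|\langle S^{-1}S_Jf,f_i\rangle|^2\le(\lambda-1)\sum_{i\in J^c}|\langle f,f_i\rangle|^2+\left(1-\frac{\lambda}{2}\right)^2\sum_{i\in I}|\langle f,f_i\rangle|^2.$$
   Context: Hilbert spaces are complex and $I$ is a countable index set. A sequence $\{f_i\}_{i\in I}$ in $\mathcal H$ is a frame for $\mathcal H$ if there are constants $A,B>0$ with $A\|f\|^2\le\sum_{i\in I}|\langle f,f_i\rangle|^2\le B\|f\|^2$ for all $f\in\mathcal H$. Its frame operator is $S:\mathcal H\to\mathcal H$, $Sf=\sum_{i\in I}\langle f,f_i\rangle f_i$, which is bounded, self-adjoint, positive and invertible. For $J\subset I$, $J^c=I\setminus J$ and $S_Jf=\sum_{i\in J}\langle f,f_i\rangle f_i$. *)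

(* Defs.v *)
From mathcomp Require Export all_boot all_order all_algebra.
From mathcomp Require Export complex.
From mathcomp Require Export all_classical all_reals all_analysis.
From mathcomp.analysis Require showcase.summability.
Export numFieldNormedType.Exports.
Import Order.TTheory GRing.Theory Num.Theory.

Set Implicit Arguments.
Unset Strict Implicit.
Unset Printing Implicit Defensive.

Local Open Scope classical_set_scope.
Local Open Scope ring_scope.
Local Open Scope complex_scope.

(* In a normed space over R[i] the norm is itself R[i]-valued; this is the same
   nonnegative number, read in R. *)
Definition rnorm (R : realType) (V : normedZmodType R[i]) (x : V) : R :=
  complex.Re `|x|.

(* A complex Hilbert space is a complete normed module H over R[i] with an
   inner product (linear in the first argument, conjugate-linear in the second)
   that induces its norm. *)
Definition induces_norm (R : realType) (H : completeNormedModType R[i])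
    (dot : {dot H for Num.conj}) : Prop :=
  forall x : H, `|x| ^+ 2 = dot x x.

Definition separable_space (T : topologicalType) : Prop :=
  exists2 D : set T, countable D & dense D.

Section Frame.
Variables (R : realType) (H : completeNormedModType R[i]).
Variables (dot : {dot H for Num.conj}) (I : countType) (f_ : I -> H).

(* A divergent sum is +oo, so the upper frame bound forces convergence. *)
Definition coef_sum (J : set I) (f : H) : \bar R :=
  (\esum_(i in J) ((rnorm (dot f (f_ i))) ^+ 2)%:E)%E.

Definition is_frame : Prop :=
  exists A B : R, [/\ 0 < A, 0 < B &
    forall f : H,
      ((A * rnorm f ^+ 2)%:E <= coef_sum setT f <= (B * rnorm f ^+ 2)%:E)%E].

(* S_J f: the sum is unconditional, i.e. a norm limit in H of the partial sums
   along the finite subsets of I directed by inclusion. *)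
Definition partial_frame_op (J : set I) (f : H) : H :=
  summability.sum
    (fun i => if i \in J then dot f (f_ i) *: f_ i else 0 : H).

Definition frame_op : H -> H := partial_frame_op setT.

(* S^{-1}; the default value 0 is only taken outside the range of S. *)
Definition frame_op_inv : H -> H :=
  'pinv_(fun=> 0 : H) [set: H] frame_op.

End Frame.

(* Main.v *)
Require Import Defs.
From mathcomp Require Import finmap ring lra.

(** Write [e] for the energy x |-> sum_I |<x, f_i>|^2 and [e_J] for the same sum
    over J.  With h = S^-1 S_J f, so that S h = S_J f, both inequalities
    follow from the nonnegativity of an energy:
    - e_J(f - h) = e_J(f) - 2 Re <S_J f, h> + e_J(h), where
      <S_J f, h> = <S h, h> = e(h) and e_J(h) <= e(h); hence
      0 <= e_J(f) - e(h).
    - e(h - (lambda/2) f) = e(h) - lambda e_J(f) + (lambda^2/4) e(f), which is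
      exactly the right-hand side minus the middle term once e(f) is split as
      e_J(f) + e_(J^c)(f).

    The analytic content is that S_J is defined by an unconditionally convergent
    sum, that <S_J x, x> = e_J(x), and that S is onto.  Only the real part of
    the inner product matters, so everything is done with the real symmetric form
    [rdot], and the operators involved are only known to be symmetric for it:
    symmetry alone already yields additivity and real homogeneity
    ([symmetric_opB], [symmetric_opZ]).

    Replacing f_i by 0 outside J turns S_J into the full operator of another
    family ([partial_frame_op_restrict]), which satisfies the upper frame bound B
    but in general not the lower one.  It is therefore enough to treat Bessel families.
    For a symmetric T with 0 <= <T x, x> <= B |x|^2 one has
    |T x|^2 <= B <T x, x> ([symmetric_op_bound]).  Applied to the finite partial
    sums it shows that they form a Cauchy family ([cvg_fin_op]); applied to S,
    together with A |x|^2 <= <S x, x>, it shows that x |-> x - S x / B shrinks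
    squared norms by the factor 1 - A/B, whence S has dense range; the lower
    bound A |x| <= |S x| then upgrades density to surjectivity
    ([symmetric_op_surj]). *)

Set Implicit Arguments.
Unset Strict Implicit.
Unset Printing Implicit Defensive.
Import Order.TTheory GRing.Theory Num.Theory.
Local Open Scope classical_set_scope.
Local Open Scope ring_scope.
Local Open Scope complex_scope.

(** * The real inner product underlying a complex Hilbert space *)

Lemma Re_conj (R : realType) (z : R[i]) : complex.Re (Num.conj z) = complex.Re z.
Proof. by case: z. Qed.

Lemma Re_mul_conjC (R : realType) (a b : R[i]) :
  complex.Re (a * Num.conj b) = complex.Re (b * Num.conj a).
Proof. by rewrite -Re_conj rmorphM/= conjCK mulrC. Qed.

Section RealInnerProduct.
Context (R : realType) (H : completeNormedModType R[i]).
Context (dot : {dot H for Num.conj}) (hdot : induces_norm dot).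
Implicit Types (x y z : H) (a b : R).

Definition rdot x y : R := complex.Re (dot x y).

Lemma rdotC x y : rdot x y = rdot y x.
Proof.
rewrite /rdot hermC expr0 mul1r.
exact: Re_conj.
Qed.

Lemma rdotBl x y z : rdot (x - y) z = rdot x z - rdot y z.
Proof. by rewrite /rdot linearBl raddfB. Qed.

Lemma rdotZl a x y : rdot (a%:C *: x) y = a * rdot x y.
Proof.
rewrite /rdot linearZl_LR /=; case: (dot x y) => u v /=.
by rewrite mul0r subr0.
Qed.

Lemma rdotBr x y z : rdot x (y - z) = rdot x y - rdot x z.
Proof. by rewrite !(rdotC x) rdotBl. Qed.

Lemma rdotZr a x y : rdot x (a%:C *: y) = a * rdot x y.
Proof. by rewrite !(rdotC x) rdotZl. Qed.

Lemma rdotNN x y : rdot (- x) (- y) = rdot x y.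
Proof. by rewrite /rdot linearNl linearNr opprK. Qed.

Lemma norm_rnorm (V : normedZmodType R[i]) (x : V) : `|x| = (rnorm x)%:C.
Proof. by rewrite /rnorm RRe_real// normr_real. Qed.

Lemma rnorm_ge0 (V : normedZmodType R[i]) (x : V) : 0 <= rnorm x.
Proof. by rewrite -ler0c -norm_rnorm. Qed.

Lemma rdotxx x : rdot x x = rnorm x ^+ 2.
Proof. by rewrite /rdot -hdot norm_rnorm -rmorphXn. Qed.

Lemma rdot_ge0 x : 0 <= rdot x x.
Proof. by rewrite rdotxx sqr_ge0. Qed.

Lemma rdot_eq0 x : rdot x x = 0 -> x = 0.
Proof.
rewrite rdotxx => /eqP; rewrite sqrf_eq0 => /eqP x0.
by apply/normr0_eq0; rewrite norm_rnorm x0.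
Qed.

Lemma rdot_inj x y : (forall z, rdot x z = rdot y z) -> x = y.
Proof.
by move=> xy; apply/subr0_eq/rdot_eq0; rewrite rdotBl xy subrr.
Qed.

(** Cauchy-Schwarz, from the nonnegativity of |y|^2 x - <x, y> y. *)
Lemma rdot_CS x y : rdot x y ^+ 2 <= rdot x x * rdot y y.
Proof.
have [/rdot_eq0 ->|y0] := eqVneq (rdot y y) 0.
  have r0 z : rdot z 0 = 0 by rewrite -(subrr 0) rdotBr subrr.
  by rewrite !r0 expr0n mulr0.
have ygt0 : 0 < rdot y y by rewrite lt_neqAle eq_sym y0 rdot_ge0.
have := rdot_ge0 ((rdot y y)%:C *: x - (rdot x y)%:C *: y).
rewrite !(rdotBl, rdotBr, rdotZl, rdotZr) (rdotC y x) => h.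
rewrite -subr_ge0 -(pmulr_rge0 _ ygt0).
by apply: le_trans h _; rewrite le_eqVlt; apply/orP; left; apply/eqP; ring.
Qed.

(** The norm of [H] takes its values in [R[i]]; this comparison, with
    [pos_complexE] for the choice of the radii, lets every limit be computed with
    real squared distances. *)
Lemma norm_lt_sqr x (e : R) : 0 < e -> (`|x| < e%:C) = (rdot x x < e ^+ 2).
Proof.
move=> e0; rewrite norm_rnorm ltcR rdotxx ltr_pXn2r// nnegrE ?rnorm_ge0//.
exact: ltW.
Qed.

Lemma pos_complexE (e : R[i]) : 0 < e -> exists2 r : R, 0 < r & e = r%:C.
Proof.
move=> e0; have er : e = (complex.Re e)%:C by rewrite RRe_real// gtr0_real.
by exists (complex.Re e) => //; rewrite -ltcR -er.
Qed.

Lemma cvg_rdotP (T : Type) (F : set_system T) {FF : Filter F} (u : T -> H) l :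
  u t @[t --> F] --> l <->
  forall e, 0 < e -> \forall t \near F, rdot (l - u t) (l - u t) < e.
Proof.
split=> [/cvgrPdist_lt ul e e0|ul].
  have e0' : 0 < (Num.sqrt e)%:C by rewrite ltcR sqrtr_gt0.
  apply: filterS (ul _ e0') => t.
  by rewrite norm_lt_sqr ?sqrtr_gt0// sqr_sqrtr// ltW.
apply/cvgrPdist_lt => _ /pos_complexE[e e0 ->].
apply: filterS (ul (e ^+ 2) _); last exact: exprn_gt0.
by move=> t; rewrite norm_lt_sqr.
Qed.

(** Cauchyness is tested here against one centre per radius, which is how both
    the partial sums and the approximate solutions of T x = y present
    themselves. *)
Lemma rdot_cauchy_cvg (F : set_system H) {FF : ProperFilter F} :
  (forall e, 0 < e -> exists x, F [set y | rdot (x - y) (x - y) < e]) -> cvg F.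
Proof.
move=> Fc; apply: cauchy_cvg; apply: cauchy_exP => _ /pos_complexE[e e0 ->].
have [x Fx] := Fc (e ^+ 2) (exprn_gt0 _ e0).
exists x; apply: filterS Fx => y /=.
by rewrite -ball_normE /= norm_lt_sqr.
Qed.

Lemma cvg_rdotl (T : Type) (F : set_system T) {FF : Filter F} (u : T -> H) l y :
  u t @[t --> F] --> l -> rdot (u t) y @[t --> F] --> rdot l y.
Proof.
move=> /cvg_rdotP ul; apply/cvgrPdist_lt => e e0.
have y1 : 0 < rdot y y + 1 by rewrite ltr_wpDl// rdot_ge0.
have := ul (e ^+ 2 / (rdot y y + 1)) (divr_gt0 (exprn_gt0 2 e0) y1).
apply: filterS => t; rewrite ltr_pdivlMr// => h.
rewrite -rdotBl -(@ltr_pXn2r _ 2)// ?nnegrE ?normr_ge0// ?(ltW e0)//.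
rewrite -normrX ger0_norm ?sqr_ge0//.
apply: le_lt_trans (rdot_CS _ _) (le_lt_trans _ h).
by rewrite ler_wpM2l ?rdot_ge0// lerDl.
Qed.

End RealInnerProduct.

(** * Symmetric operators *)

Section SymmetricOperators.
Context (R : realType) (H : completeNormedModType R[i]).
Context (dot : {dot H for Num.conj}) (hdot : induces_norm dot).
Local Notation ip := (rdot dot).
Context (T : H -> H) (Tsym : forall x y, ip (T x) y = ip (T y) x).

(** Moving T to the other side of the form turns an identity about T into the
    corresponding identity of the form, as for [symmetric_opZ]. *)
Lemma symmetric_opB x y : T (x - y) = T x - T y.
Proof.
apply: (rdot_inj hdot) => z.
by rewrite Tsym rdotBr rdotBl !(Tsym z).
Qed.

Lemma symmetric_opZ (a : R) x : T (a%:C *: x) = a%:C *: T x.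
Proof.
apply: (rdot_inj hdot) => z.
by rewrite Tsym rdotZr rdotZl Tsym.
Qed.

(** Cauchy-Schwarz for the form <T x, y> would give this after dividing by
    |T x|^2; evaluating the form at B x - T x avoids the division. *)
Lemma symmetric_op_bound (B : R) : 0 < B ->
  (forall x, 0 <= ip (T x) x <= B * ip x x) ->
  forall x, ip (T x) (T x) <= B * ip (T x) x.
Proof.
move=> B0 TB x; set v := T x.
have /andP[h _] := TB (B%:C *: x - v).
have /andP[_ hv] := TB v.
move: h; rewrite symmetric_opB symmetric_opZ -/v.
rewrite !(rdotBl, rdotBr, rdotZl, rdotZr) (Tsym v x) -/v => h.
rewrite -subr_ge0 -(pmulr_rge0 _ B0).
nra.
Qed.

Context (A B : R) (A0 : 0 < A).
Context (AT : forall x, A * ip x x <= ip (T x) x).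
Context (TB : forall x, ip (T x) x <= B * ip x x).

(** From |T x - A x|^2 >= 0 and A <T x, x> >= A^2 |x|^2. *)
Lemma symmetric_op_expand x : A ^+ 2 * ip x x <= ip (T x) (T x).
Proof.
have := rdot_ge0 hdot (T x - A%:C *: x).
rewrite !(rdotBl, rdotBr, rdotZl, rdotZr) (rdotC dot x (T x)).
have := ler_wpM2l (ltW A0) (AT x).
by nra.
Qed.

(** Here |x - T x / B|^2 = |x|^2 - 2 <T x, x> / B + |T x|^2 / B^2, where the
    last term is at most <T x, x> / B. *)
Lemma residual_contraction : 0 < B -> A <= B -> forall x,
  ip (x - B^-1%:C *: T x) (x - B^-1%:C *: T x) <= (1 - A / B) * ip x x.
Proof.
move=> B0 AB x.
have TB0 z : 0 <= ip (T z) z <= B * ip z z.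
  by rewrite TB andbT (le_trans _ (AT z))// mulr_ge0 ?rdot_ge0// ltW.
have := symmetric_op_bound B0 TB0 x; have := AT x.
rewrite !(rdotBl, rdotBr, rdotZl, rdotZr) (rdotC dot x (T x)).
have c0 : 0 < B^-1 by rewrite invr_gt0.
have cB : B^-1 * B = 1 by rewrite mulVf// gt_eqF.
move: (ip (T x) (T x)) (ip (T x) x) (ip x x) => u v w h1 h2.
have k1 : B^-1 * (B^-1 * u) <= B^-1 * v.
  rewrite ler_pM2l//; apply: le_trans (ler_wpM2l (ltW c0) h2) _.
  by rewrite mulrA cB mul1r.
have k2 : (A / B) * w <= B^-1 * v by rewrite (mulrC A) -mulrA ler_pM2l.
lra.
Qed.

(** Richardson iteration x + (y - T x) / B replaces the residual r = y - T x
    by r - T r / B, so that the squared residuals decay geometrically. *)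
Lemma residual_small : 0 < B -> A <= B -> forall y e, 0 < e ->
  exists x, ip (y - T x) (y - T x) < e.
Proof.
move=> B0 AB y e e0; set q := 1 - A / B.
have q0 : 0 <= q by rewrite subr_ge0 ler_pdivrMr// mul1r.
have q1 : q < 1 by rewrite ltrBlDr ltrDl divr_gt0.
have iter_residual n : exists x, ip (y - T x) (y - T x) <= q ^+ n * ip y y.
  elim: n => [|n [x hx]].
    exists 0; rewrite mul1r.
    have := symmetric_opB 0 0; rewrite !subrr => ->.
    by rewrite subr0.
  (* x + (y - T x) / B, written as a difference so that symmetric_opB applies *)
  exists (x - (- B^-1)%:C *: (y - T x)).
  rewrite symmetric_opB symmetric_opZ rmorphN scaleNr opprK opprD addrA.
  apply: le_trans (residual_contraction B0 AB _) _.
  by rewrite exprS -mulrA ler_wpM2l.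
have y1 : 0 < ip y y + 1 by rewrite ltr_wpDl// rdot_ge0.
have qn : q ^+ n @[n --> \oo] --> 0 by apply: cvg_expr; rewrite ger0_norm.
have /cvgrPdist_lt/(_ _ (divr_gt0 e0 y1))[n _ /(_ n (leqnn n))/=] := qn.
rewrite sub0r normrN ger0_norm ?exprn_ge0// ltr_pdivlMr// => hn.
have [x hx] := iter_residual n; exists x.
apply: le_lt_trans hx (le_lt_trans _ hn).
by rewrite ler_wpM2l ?exprn_ge0// lerDl.
Qed.

(** The sets of approximate solutions of T x = y generate a proper filter,
    which is Cauchy because A |x| <= |T x|; its limit is a solution, since both
    sides agree when tested against any vector. *)
Lemma symmetric_op_surj : 0 < B -> A <= B -> forall y, exists x, T x = y.
Proof.
move=> B0 AB y.
pose F := filter_from [set e : R | 0 < e]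
  (fun e => [set x | ip (y - T x) (y - T x) < e]).
have FF : ProperFilter F.
  apply: filter_from_proper; last by move=> e /(residual_small B0 AB y).
  apply: filter_from_filter; first by exists 1; rewrite /= ltr01.
  move=> e1 e2 /= e10 e20; exists (Num.min e1 e2).
    by rewrite /= lt_min e10.
  by move=> x /=; rewrite lt_min => /andP[].
have /cvg_ex[/= l Fl] : cvg F.
  apply: (rdot_cauchy_cvg hdot) => e e0.
  have d0 : 0 < A ^+ 2 * e / 4 by rewrite divr_gt0// mulr_gt0// exprn_gt0.
  have [x hx] := residual_small B0 AB y d0.
  exists x; exists (A ^+ 2 * e / 4) => // z /= hz.
  rewrite -(ltr_pM2l (exprn_gt0 2 A0)).
  apply: le_lt_trans (symmetric_op_expand _) _.
  have -> : T (x - z) = (y - T z) - (y - T x).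
    by rewrite symmetric_opB opprB [RHS]addrC subrKA.
  move: (y - T x) (y - T z) hx hz => a b.
  (* parallelogram law: |b - a|^2 <= 2 |a|^2 + 2 |b|^2 *)
  have := rdot_ge0 hdot (a - (- 1)%:C *: b).
  by rewrite !(rdotBl, rdotBr, rdotZl, rdotZr) (rdotC dot b a); lra.
exists l; apply: (rdot_inj hdot) => w.
have Ty : T x @[x --> F] --> y.
  by apply/(cvg_rdotP hdot) => e e0; exists e.
have Tl : ip (T x) w @[x --> F] --> ip (T l) w.
  under eq_fun do rewrite Tsym rdotC.
  by rewrite Tsym rdotC; apply: (cvg_rdotl hdot); exact: Fl.
have Tyw : ip (T x) w @[x --> F] --> ip y w by exact: (cvg_rdotl hdot).
by rewrite -(cvg_lim (@Rhausdorff R) Tl) (cvg_lim (@Rhausdorff R) Tyw).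
Qed.

End SymmetricOperators.

(** * The operator of a Bessel family *)

#[local] Existing Instance summability.totally_filter.

Lemma big_fset_split (I : choiceType) (V : nmodType) (A0 A : {fset I})
    (F : I -> V) : (A0 `<=` A)%fset ->
  \sum_(i <- A) F i = \sum_(i <- A0) F i + \sum_(i <- (A `\` A0)%fset) F i.
Proof.
move=> /fsubsetP A0A; rewrite (big_fsetID _ (mem A0)).
congr (_ + _); apply: eq_fbigl => i; rewrite !inE/=; last by rewrite andbC.
by apply/andP/idP => [[]//|iA0]; split => //; exact: A0A.
Qed.

Section Bessel.
Context (R : realType) (H : completeNormedModType R[i]).
Context (dot : {dot H for Num.conj}) (hdot : induces_norm dot).
Local Notation ip := (rdot dot).
Context (I : countType) (g : I -> H).
Implicit Types (A : {fset I}) (x y : H).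

Definition energy x : R := fine (coef_sum dot g setT x).

Definition fin_op A x : H := \sum_(i <- A) dot x (g i) *: g i.

Definition fin_energy A x : R := \sum_(i <- A) rnorm (dot x (g i)) ^+ 2.

Lemma rdot_fin_op A x y :
  ip (fin_op A x) y =
  \sum_(i <- A) complex.Re (dot x (g i) * Num.conj (dot y (g i))).
Proof.
rewrite /rdot /fin_op linear_sumlz raddf_sum; apply: eq_bigr => i _.
by rewrite linearZl_LR /= (hermC dot (g i)) expr0 mul1r.
Qed.

Lemma fin_opC A x y : ip (fin_op A x) y = ip (fin_op A y) x.
Proof.
rewrite !rdot_fin_op; apply: eq_bigr => i _.
exact: Re_mul_conjC.
Qed.

Lemma rdot_fin_opxx A x : ip (fin_op A x) x = fin_energy A x.
Proof.
rewrite rdot_fin_op; apply: eq_bigr => i _.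
by rewrite -normCK norm_rnorm -rmorphXn.
Qed.

Context (B : R) (B0 : 0 < B).
Context (gB : forall x, (coef_sum dot g setT x <= (B * rnorm x ^+ 2)%:E)%E).

Lemma energyE x : (energy x)%:E = coef_sum dot g setT x.
Proof.
rewrite /energy fineK// ge0_fin_numE; last first.
  by apply: esum_ge0 => i _; rewrite lee_fin sqr_ge0.
by rewrite (le_lt_trans (gB x))// ltry.
Qed.

Lemma energy_bound x : energy x <= B * ip x x.
Proof. by rewrite -lee_fin energyE rdotxx. Qed.

Lemma fin_energy_le A x : fin_energy A x <= energy x.
Proof.
rewrite -lee_fin energyE; apply: esum_ge; exists [set` A].
  by split => //; exact: finite_fset.
by rewrite -fsbig_seq ?fset_uniq// sumEFin.
Qed.

Lemma fin_energy_ge0 A x : 0 <= fin_energy A x.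
Proof. by apply: sumr_ge0 => i _; rewrite sqr_ge0. Qed.

Lemma energy_ge0 x : 0 <= energy x.
Proof. exact: le_trans (fin_energy_ge0 fset0 x) (fin_energy_le _ _). Qed.

(** This is what controls the tails of the series defining the frame operator. *)
Lemma fin_op_bound A x :
  ip (fin_op A x) (fin_op A x) <= B * fin_energy A x.
Proof.
rewrite -rdot_fin_opxx; apply: symmetric_op_bound => //; first exact: fin_opC.
move=> y; rewrite rdot_fin_opxx fin_energy_ge0/=.
exact: le_trans (fin_energy_le _ _) (energy_bound _).
Qed.

Lemma energy_approx x (e : R) : 0 < e -> exists A, energy x - e < fin_energy A x.
Proof.
move=> e0; have fx : coef_sum dot g setT x \is a fin_num by rewrite -energyE.
have [_ [X [Xfin _] <-]] := ub_ereal_sup_adherent e0 fx.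
rewrite -/(esum _ _) -/(coef_sum dot g setT x) -energyE.
rewrite fsbig_finite//= sumEFin -EFinB lte_fin => h.
by exists (fset_set X).
Qed.

Lemma cvg_fin_energy x :
  fin_energy A x @[A --> summability.totally] --> energy x.
Proof.
apply/cvgrPdist_lt => e e0; have [A0 hA0] := energy_approx x e0.
exists A0 => // A /= A0A.
rewrite ger0_norm ?subr_ge0 ?fin_energy_le// ltrBlDr -ltrBlDl.
apply: lt_le_trans hA0 _.
by rewrite /fin_energy (big_fset_split _ A0A) lerDl; exact: fin_energy_ge0.
Qed.

(** Two partial sums, one of which extends the other, differ by a partial sum
    over the added indices; its squared norm is at most B times the energy
    carried by those indices, and finitely many indices carry all but an
    arbitrarily small part of the energy. *)
Lemma cvg_fin_op x :
  cvg (fin_op A x @[A --> summability.totally]).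
Proof.
apply: (rdot_cauchy_cvg hdot) => e e0.
have [A0 hA0] := energy_approx x (divr_gt0 e0 B0).
exists (fin_op A0 x); exists A0 => // A /= A0A.
have -> : fin_op A0 x - fin_op A x = - fin_op (A `\` A0)%fset x.
  by rewrite {2}/fin_op (big_fset_split _ A0A) opprD addNKr.
rewrite rdotNN.
apply: le_lt_trans (fin_op_bound _ _) _.
rewrite -ltr_pdivlMl// mulrC.
have := fin_energy_le A x; rewrite /fin_energy (big_fset_split _ A0A) -/(fin_energy _ _).
rewrite -/(fin_energy _ _).
lra.
Qed.

Lemma frame_op_cvg x :
  fin_op A x @[A --> summability.totally] --> frame_op dot g x.
Proof.
rewrite /frame_op /partial_frame_op /summability.sum.
rewrite (_ : summability.partial_sum _ = fin_op^~ x); first exact: cvg_fin_op.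
apply/funext => A; rewrite /summability.partial_sum /fin_op big_seq_fsetE/=.
by apply: eq_bigr => i _; rewrite in_setT.
Qed.

Lemma cvg_rdot_fin_op x y :
  ip (fin_op A x) y @[A --> summability.totally] --> ip (frame_op dot g x) y.
Proof. by apply: (cvg_rdotl hdot); exact: frame_op_cvg. Qed.

(** Inherited from the finite partial sums by passing to the limit, as is
    [frame_opxx]. *)
Lemma frame_opC x y : ip (frame_op dot g x) y = ip (frame_op dot g y) x.
Proof.
rewrite -(cvg_lim (@Rhausdorff R) (@cvg_rdot_fin_op x y)).
rewrite -(cvg_lim (@Rhausdorff R) (@cvg_rdot_fin_op y x)).
by under eq_fun do rewrite fin_opC.
Qed.

Lemma frame_opxx x : ip (frame_op dot g x) x = energy x.
Proof.
rewrite -(cvg_lim (@Rhausdorff R) (@cvg_rdot_fin_op x x)).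
rewrite -(cvg_lim (@Rhausdorff R) (@cvg_fin_energy x)).
by under eq_fun do rewrite rdot_fin_opxx.
Qed.

End Bessel.

(** * Restriction to a set of indices *)

Section RestrictedFamily.
Context (R : realType) (H : completeNormedModType R[i]).
Context (dot : {dot H for Num.conj}).
Context (I : countType) (f_ : I -> H) (J : set I).

Definition restrict_family : I -> H := fun i => if i \in J then f_ i else 0.
Local Notation g := restrict_family.

Lemma coef_sum_restrict x : coef_sum dot f_ J x = coef_sum dot g setT x.
Proof.
rewrite /coef_sum esum_mkcond; apply: eq_esum => i _.
rewrite /restrict_family; case: ifPn => // _.
by rewrite linear0r /rnorm normr0 /= expr0n.
Qed.

Lemma partial_frame_op_restrict x :
  partial_frame_op dot f_ J x = frame_op dot g x.
Proof.
rewrite /frame_op /partial_frame_op; congr summability.sum.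
apply/funext => i; rewrite in_setT /restrict_family.
by case: ifPn => // _; rewrite linear0r scale0r.
Qed.

Lemma coef_sum_le x : (coef_sum dot f_ J x <= coef_sum dot f_ setT x)%E.
Proof.
rewrite /coef_sum esum_mkcond; apply: le_esum => i _.
by case: ifPn => // _; rewrite lee_fin sqr_ge0.
Qed.

Lemma coef_sumID x :
  coef_sum dot f_ setT x = (coef_sum dot f_ J x + coef_sum dot f_ (~` J) x)%E.
Proof.
rewrite /coef_sum (esumID J) ?setTI// => i _.
by rewrite lee_fin sqr_ge0.
Qed.

End RestrictedFamily.

(** * Invertibility of the frame operator and the inequalities *)

Lemma frame_op_surj (R : realType) (H : completeNormedModType R[i])
    (dot : {dot H for Num.conj}) (hdot : induces_norm dot)
    (I : countType) (f_ : I -> H) :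
  is_frame dot f_ -> forall y, exists x, frame_op dot f_ x = y.
Proof.
move=> [A [B [A0 B0 AB]]].
have fB x : (coef_sum dot f_ setT x <= (B * rnorm x ^+ 2)%:E)%E.
  by have /andP[] := AB x.
(* A <= B can fail when H is trivial, hence the minimum *)
have m0 : 0 < Num.min A B by rewrite lt_min A0.
apply: (@symmetric_op_surj _ _ _ hdot _ _ (Num.min A B) B) => //.
- exact: frame_opC fB.
- move=> x; rewrite (frame_opxx hdot B0 fB) -lee_fin (energyE fB).
  have /andP[h _] := AB x; apply: le_trans h.
  by rewrite lee_fin (rdotxx hdot) ler_wpM2r ?sqr_ge0// ge_min lexx.
- by move=> x; rewrite (frame_opxx hdot B0 fB); exact: energy_bound.
- by rewrite ge_min lexx orbT.
Qed.

Lemma frame_op_invK (R : realType) (H : completeNormedModType R[i])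
    (dot : {dot H for Num.conj}) (hdot : induces_norm dot)
    (I : countType) (f_ : I -> H) :
  is_frame dot f_ -> forall y, frame_op dot f_ (frame_op_inv dot f_ y) = y.
Proof.
move=> fr y; apply: pinvK; apply: mem_set.
by have [x <-] := frame_op_surj hdot fr y; exists x.
Qed.

Theorem corollary2p6 (R : realType) (H : completeNormedModType R[i])
    (dot : {dot H for Num.conj}) (hdot : induces_norm dot)
    (hsep : separable_space H)
    (I : countType) (f_ : I -> H) (hframe : is_frame dot f_)
    (lambda : R) (J : set I) (f : H) :
  (0 <= coef_sum dot f_ J f
        - coef_sum dot f_ setT
            (frame_op_inv dot f_ (partial_frame_op dot f_ J f))
     <= (lambda - 1)%:E * coef_sum dot f_ (~` J) f
        + ((1 - lambda / 2) ^+ 2)%:E * coef_sum dot f_ setT f)%E.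
Proof.
set h := frame_op_inv _ _ _.
have Sh : frame_op dot f_ h = partial_frame_op dot f_ J f by exact: frame_op_invK.
have [A [B [A0 B0 AB]]] := hframe.
have fB x : (coef_sum dot f_ setT x <= (B * rnorm x ^+ 2)%:E)%E.
  by have /andP[] := AB x.
have gB K x : (coef_sum dot (restrict_family f_ K) setT x <= (B * rnorm x ^+ 2)%:E)%E.
  by rewrite -coef_sum_restrict (le_trans (coef_sum_le _ _ _ _)).
move: Sh; rewrite partial_frame_op_restrict => Sh.
have eK K x : (energy dot (restrict_family f_ K) x)%:E = coef_sum dot f_ K x.
  by rewrite coef_sum_restrict; exact: energyE (gB K) x.
have eI x : (energy dot f_ x)%:E = coef_sum dot f_ setT x by exact: energyE fB x.
have efg : energy dot f_ f = energy dot (restrict_family f_ J) f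
                           + energy dot (restrict_family f_ (~` J)) f.
  by apply: EFin_inj; rewrite EFinD eI !eK; exact: coef_sumID.
have ehJ : energy dot (restrict_family f_ J) h <= energy dot f_ h.
  by rewrite -lee_fin eK eI; exact: coef_sum_le.
rewrite -(eK J) -(eK (~` J)) -!eI.
rewrite -EFinB -!EFinM -EFinD !lee_fin.
have symJ := frame_opC hdot B0 (gB J).
have symf := frame_opC hdot B0 fB.
have eh : rdot dot (frame_op dot (restrict_family f_ J) f) h = energy dot f_ h.
  by rewrite -Sh (frame_opxx hdot B0 fB).
apply/andP; split.
- have := energy_ge0 (gB J) (f - h).
  rewrite -(frame_opxx hdot B0 (gB J)) (symmetric_opB hdot symJ).
  rewrite !(rdotBl, rdotBr) (symJ h f) eh !(frame_opxx hdot B0 (gB J)).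
  lra.
- have := energy_ge0 fB (h - (lambda / 2)%:C *: f).
  rewrite -(frame_opxx hdot B0 fB) (symmetric_opB hdot symf).
  rewrite (symmetric_opZ hdot symf) !(rdotBl, rdotBr, rdotZl, rdotZr).
  rewrite (symf f h) Sh !(frame_opxx hdot B0 fB) (frame_opxx hdot B0 (gB J)).
  rewrite -Sh (frame_opxx hdot B0 fB).
  rewrite efg.
  lra.
Qed.
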